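(* Let $K$ be an algebraically closed field, let $G$ be a finite group, let $X$ be a $G$-variety over $K$, and let $k$ be a non-negative integer. The separating variety $\mathcal{V}_{\mathrm{sep}}$ of the action of $G$ on $X$ is connected in codimension $k$ if and only if $X$ is connected in codimension $k$ and $G$ is generated by $k$-reflections (on $X$).
   Context: A $G$-variety is an affine variety $X$ over the algebraically closed field $K$ (not necessarily irreducible or equidimensional, with reduced coordinate ring $K[X]$), together with an action of the finite group $G$ on $X$ by automorphisms of varieties. The induced action on $K[X]$ is $\sigma\cdot f := f\circ\sigma^{-1}$, and $K[X]^G$ is the ring of $G$-fixed elements. The separating variety is the closed subvariety $\mathcal{V}_{\mathrm{sep}} := \{(x,y)\in X\times X\mid f(x)=f(y)\text{ for all }f\in K[X]^G\}$ of $X\times X$. Since $G$ is finite, $\mathcal{V}_{\mathrm{sep}}=\{(x,\sigma x)\mid x\in X,\ \sigma\in G\}$. A Noetherian topological space $Y$ is called connected in codimension $k$ if it satisfies one of the following two equivalent properties: (i) for all closed subsets $Z\subseteq Y$ with $\operatorname{codim}_Y(Z)>k$ the space $Y\setminus Z$ is connected; (ii) for all irreducible components $Y',Y''$ of $Y$ there exists a finite sequence $Y_0,\ldots,Y_r$ of irreducible components of $Y$ with $Y_0=Y'$, $Y_r=Y''$ and $\operatorname{codim}_Y(Y_i\cap Y_{i+1})\le k$ for $i=0,\ldots,r-1$. Here the codimension of an irreducible closed subset $Z$ of $Y$ is the supremum of lengths of chains of irreducible closed subsets of $Y$ starting at $Z$, the codimension of a closed subset is the minimum of the codimensions of its irreducible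 components, and the empty set has codimension $\infty$. An element $\sigma\in G$ is a $k$-reflection (on $X$) if its fixed space $X^\sigma := \{x\in X\mid\sigma x=x\}$ has codimension at most $k$ in $X$. *)

(* Defs.v *)
From HB Require Import structures.
From mathcomp Require Import all_boot all_order all_algebra all_fingroup.
(* The notations of mpoly clash with those of the topology library. *)
From mathcomp.multinomials Require Import -(notations) mpoly.
From mathcomp Require Import boolp classical_sets topology ereal.

Set Implicit Arguments.
Unset Strict Implicit.
Unset Printing Implicit Defensive.

Import Order.TTheory GRing.Theory Num.Theory.

Local Open Scope classical_set_scope.
Local Open Scope ring_scope.

(* [Y] stands for a closed subset of the ambient space [T], considered with
   its subspace topology; its closed subsets are then the closed subsets of
   [T] that are included in [Y]. *)
Section Topology.
Context {T : topologicalType}.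
Implicit Types (Y Z W C : set T) (k m : nat).

Definition irreducible Z : Prop :=
  Z !=set0 /\
  forall A B, closed A -> closed B -> Z `<=` A `|` B -> Z `<=` A \/ Z `<=` B.

Definition irreducible_closed_in Y Z : Prop :=
  [/\ closed Z, Z `<=` Y & irreducible Z].

Definition irreducible_component Y C : Prop :=
  irreducible_closed_in Y C /\
  forall Z, irreducible_closed_in Y Z -> C `<=` Z -> Z = C.

Definition irreducible_chain Y Z m (c : nat -> set T) : Prop :=
  [/\ c 0%N = Z,
      (forall i, (i <= m)%N -> irreducible_closed_in Y (c i)) &
      (forall i, (i < m)%N -> c i `<` c i.+1)].

(* Lengths are embedded in [\bar rat] in order to use the suprema and infima
   of extended numbers; only naturals and [+oo] are relevant values. *)
Definition irreducible_codim Y Z : \bar rat :=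
  ereal_sup [set (m%:R)%:E | m in [set m | exists c, irreducible_chain Y Z m c]].

(* The infimum over no component is [+oo], which is the codimension of [set0]. *)
Definition codim Y Z : \bar rat :=
  ereal_inf [set irreducible_codim Y W | W in irreducible_component Z].

Lemma irreducible_codimP Y W :
  irreducible_codim Y W = -oo%E /\ (forall m c, ~ irreducible_chain Y W m c) \/
  (exists m, [/\ irreducible_codim Y W = (m%:R)%:E,
      (exists c, irreducible_chain Y W m c) &
      forall m' c, irreducible_chain Y W m' c -> (m' <= m)%N]) \/
  irreducible_codim Y W = +oo%E /\
    (forall m, exists m' c, irreducible_chain Y W m' c /\ (m < m')%N).
Proof.
rewrite /irreducible_codim; set A := [set m | _]; set S := [set _ | m in A].
have supS s : supremums S s -> A !=set0 -> ereal_sup S = s.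
  move=> Ss [a Aa]; rewrite /ereal_sup /supremum ifF; last first.
    by apply/negbTE/set0P; exists (a%:R)%:E; exists a.
  by case: xgetP => [x -> Sx|/(_ s)//]; exact: is_subset1_supremums Sx Ss.
have [A0|/set0P An0] := eqVneq A set0.
  left; split; first by rewrite /S A0 image_set0 ereal_sup0.
  move=> m c cm; suff : set0 m by [].
  by rewrite -A0; exists c.
right; have [[b Ab]|unb] := pselect (exists b, forall m, A m -> (m <= b)%N).
  left; have exA : exists m, `[< A m >] by case: An0 => m Am; exists m; apply/asboolP.
  have ubA m : `[< A m >] -> (m <= b)%N by move/asboolP/Ab.
  have [m /asboolP Am mmax] := ex_maxnP exA ubA; exists m; split.
  - apply: supS => //; split=> [_ [i Ai <-]|y Sy].
      by rewrite lee_fin ler_nat mmax//; apply/asboolP.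
    by apply: Sy; exists m.
  - by [].
  - by move=> m' c cm'; apply: mmax; apply/asboolP; exists c.
right.
have bigA m : exists m', A m' /\ (m < m')%N.
  apply: contrapT => /forallNP H; apply: unb; exists m => m' Am'.
  by rewrite leqNgt; apply/negP => mm'; exact: (H m').
split; last by move=> m; have [m' [[c ?] ?]] := bigA m; exists m', c.
apply: supS => //; split=> [y _|]; first exact: leey.
move=> [y| |] Sy //.
- have [m] : exists m : nat, y <= m%:R.
    exists (Num.bound `|y|); apply: le_trans (ler_norm y) _.
    exact: ltW (archi_boundP (normr_ge0 y)).
  move=> ym; have [m' [Am' mm']] := bigA m.
  have /Sy : S (m'%:R)%:E by exists m'.
  by rewrite lee_fin => /le_trans/(_ ym); rewrite ler_nat leqNgt mm'.
- by case: An0 => a Aa; have /Sy : S (a%:R)%:E by exists a.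
Qed.

Lemma irreducible_codim_leP k Y W :
  (irreducible_codim Y W <= (k%:R)%:E)%E <->
  forall m c, irreducible_chain Y W m c -> (m <= k)%N.
Proof.
case: (irreducible_codimP Y W) => [[-> nc]|[[m [-> [c cm] mmax]]|[-> unb]]].
- by split=> [_ m c /nc//|_]; rewrite leNye.
- rewrite lee_fin ler_nat; split=> [mk m' c' /mmax /leq_trans|]; first exact.
  by move=> /(_ m c cm).
- split=> [|H]; first by rewrite leye_eq.
  by have [m' [c [/H + km']]] := unb k; rewrite leqNgt km'.
Qed.

Lemma codim_leP k Y Z :
  (codim Y Z <= (k%:R)%:E)%E <->
  exists2 W, irreducible_component Z W &
    forall m c, irreducible_chain Y W m c -> (m <= k)%N.
Proof.
rewrite /codim; set S := [set _ | W in _]; split.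
  move=> infk; have /ereal_inf_lt[_ [W ZW <-] Wk] :
      (ereal_inf S < (k.+1%:R)%:E)%E.
    by apply: le_lt_trans infk _; rewrite lte_fin ltr_nat.
  exists W => // m c cm; move: Wk.
  case: (irreducible_codimP Y W) => [[_ /(_ _ _ cm)//]|[|[->//]]].
  move=> [m' [-> _ /(_ _ _ cm) mm']]; rewrite lte_fin ltr_nat ltnS.
  exact: leq_trans.
move=> [W ZW /irreducible_codim_leP Wk].
have [s [Ss sS]] : exists s, S s /\ lbound S s.
  have [?|noo] := pselect (S -oo%E).
    by exists -oo%E; split=> // y _; rewrite leNye.
  have exS : exists j, `[< exists2 s, S s & (s <= (j%:R)%:E)%E >].
    by exists k; apply/asboolP; exists (irreducible_codim Y W) => //; exists W.
  have [j /asboolP[s Ss sj] jmin] := ex_minnP exS; exists s; split=> // _ [W' ZW' <-].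
  apply: le_trans sj _.
  case: (irreducible_codimP Y W') => [[W'oo _]|[[m' [W'm' _ _]]|[-> _]]].
  - by case: noo; rewrite -W'oo; exists W'.
  - rewrite W'm' lee_fin ler_nat; apply: jmin; apply/asboolP.
    by exists (irreducible_codim Y W'); [exists W' | rewrite W'm'].
  - exact: leey.
have infS : ereal_inf S = s.
  rewrite /ereal_inf /ereal_sup /supremum ifF; last first.
    by apply/negbTE/set0P; exists (- s)%E; exists s.
  have supN : supremums (-%E @` S)%E (- s)%E.
    split=> [_ [y Sy <-]|y]; first by rewrite leeN2; exact: sS.
    by apply; exists s.
  case: xgetP => [x -> Sx|/(_ (- s)%E)//].
  by rewrite (is_subset1_supremums Sx supN) oppeK.
by rewrite infS; apply: le_trans (sS _ _) Wk; exists W.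
Qed.

Definition connected_in_codim k Y : Prop :=
  forall Y' Y'', irreducible_component Y Y' -> irreducible_component Y Y'' ->
  exists (r : nat) (C : nat -> set T),
    [/\ C 0%N = Y', C r = Y'',
        (forall i, (i <= r)%N -> irreducible_component Y (C i)) &
        (forall i, (i < r)%N ->
           (codim Y (C i `&` C i.+1) <= (k%:R)%:E)%E)].

End Topology.

Definition affine_space (K : closedFieldType) (n : nat) : Type := 'rV[K]_n.

HB.instance Definition _ K n := Choice.on (affine_space K n).

Definition evalmp (K : closedFieldType) n (p : mpoly n K)
    (x : affine_space K n) : K :=
  meval (fun i => (x : 'rV[K]_n) ord0 i) p.

Definition zero_locus (K : closedFieldType) n (S : set (mpoly n K)) :
    set (affine_space K n) :=
  [set x | forall p, S p -> evalmp p x = 0].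

Section Zariski.
Context (K : closedFieldType) (n : nat).

Definition zariski_open (U : set (affine_space K n)) : Prop :=
  exists S : set (mpoly n K), U = ~` zero_locus S.

Lemma zariski_openP (U : set (affine_space K n)) :
  zariski_open U <->
  forall x, U x -> exists2 p : mpoly n K, evalmp p x != 0 &
    forall y, evalmp p y != 0 -> U y.
Proof.
split=> [[S ->] x /= /existsNP[p /not_implyP[Sp /eqP px]]|UP].
  by exists p => // y /eqP py /(_ p Sp).
exists [set p | forall y, evalmp p y != 0 -> U y].
apply/seteqP; split=> x /=.
  by move=> /UP[p px pU] /(_ p pU) p0; rewrite p0 eqxx in px.
by move=> /existsNP[p /not_implyP[pU /eqP px]]; exact: pU.
Qed.

Lemma zariski_openT : zariski_open setT.
Proof.
apply/zariski_openP => x _; exists 1 => //.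
by rewrite /evalmp meval1 oner_neq0.
Qed.

Lemma zariski_openI : setI_closed zariski_open.
Proof.
move=> A B /zariski_openP oA /zariski_openP oB; apply/zariski_openP.
move=> x [/oA[p px pA] /oB[q qx qB]]; exists (p * q).
  by rewrite /evalmp mevalM mulf_neq0.
by move=> y; rewrite /evalmp mevalM mulf_eq0 negb_or => /andP[/pA ? /qB].
Qed.

Lemma zariski_open_bigU (I : Type) (f : I -> set (affine_space K n)) :
  (forall i, zariski_open (f i)) -> zariski_open (\bigcup_i f i).
Proof.
move=> of_; apply/zariski_openP => x [i _ /(zariski_openP (f i)).1].
by case=> // p px pf; exists p => // y /pf; exists i.
Qed.

HB.instance Definition _ := isOpenTopological.Build (affine_space K n)
  zariski_openT zariski_openI zariski_open_bigU.

Lemma zariski_closedP (A : set (affine_space K n)) :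
  closed A <-> exists S : set (mpoly n K), A = zero_locus S.
Proof.
rewrite -openC; split=> [[S]|[S ->]]; last by exists S.
by move=> /(congr1 setC); rewrite !setCK; exists S.
Qed.

End Zariski.

Section Varieties.
Context {K : closedFieldType}.

(* The elements of the coordinate ring K[X]: restrictions of polynomials to X. *)
Definition regular_function n (X : set (affine_space K n))
    (f : affine_space K n -> K) : Prop :=
  exists p : mpoly n K, forall x, X x -> f x = evalmp p x.

Definition regular_map n n' (X : set (affine_space K n))
    (f : affine_space K n -> affine_space K n') : Prop :=
  exists p : 'I_n' -> mpoly n K,
    forall x, X x -> f x = \row_j evalmp (p j) x.

(* A left action of [G] on [X] by morphisms; each of them is an automorphism
   as its inverse is also given by the action. Affine varieties are Zariski
   closed subsets of an affine space, not necessarily irreducible. The values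
   of [act s] outside of [X] are irrelevant. *)
Record Gvariety (gT : finGroupType) (G : {group gT}) n
    (X : set (affine_space K n))
    (act : gT -> affine_space K n -> affine_space K n) : Prop := {
  Gvariety_closed : closed X;
  Gvariety_stable : forall s x, s \in G -> X x -> X (act s x);
  Gvariety_regular : forall s, s \in G -> regular_map X (act s);
  Gvariety_act1 : forall x, X x -> act 1%g x = x;
  Gvariety_actM : forall s t x, s \in G -> t \in G -> X x ->
    act (s * t)%g x = act s (act t x)
}.

Section Action.
Context {gT : finGroupType} (G : {group gT}) {n : nat}.
Variables (X : set (affine_space K n)).
Variables (act : gT -> affine_space K n -> affine_space K n).

Definition invariant_function (f : affine_space K n -> K) : Prop :=
  regular_function X f /\
  forall s x, s \in G -> X x -> f (act s^-1%g x) = f x.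

(* The point (x, y) of X * X is [row_mx x y], so that the topology is the
   Zariski topology of the variety X * X and not the product topology. *)
Definition separating_variety : set (affine_space K (n + n)) :=
  [set z | exists x y : affine_space K n,
     [/\ z = row_mx x y, X x, X y &
         forall f, invariant_function f -> f x = f y]].

Definition fixed_space (s : gT) : set (affine_space K n) :=
  [set x | X x /\ act s x = x].

Definition reflection (k : nat) (s : gT) : Prop :=
  (codim X (fixed_space s) <= (k%:R)%:E)%E.

Definition generated_by_reflections (k : nat) : Prop :=
  <<[set s in G | `[< reflection k s >] ]%SET>>%g = G.

End Action.
End Varieties.

(* Main.v *)
Require Import Defs.
From Stdlib Require Import Relation_Operators Operators_Properties.
From mathcomp Require Import all_boot all_order all_algebra all_fingroup.
From mathcomp.multinomials Require Import -(notations) mpoly.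
From mathcomp Require Import boolp classical_sets topology ereal.

(** The separating variety is the union of the graphs of the elements of G,
    because invariants separate orbits. Each graph is isomorphic to X through
    the first projection, so the components of the separating variety are the
    graphs of s on the components C of X, and codimensions can be computed in
    X. The graphs of s on C and of t on D meet over the points of C ∩ D fixed
    by s^-1 t: they are adjacent in codimension k iff these contain an
    irreducible closed set of codimension at most k. Hence a path in the
    separating variety projects to a path in X, and each of its steps changes
    the group element by a k-reflection. Conversely, paths in X lift to each
    graph, and one moves from the graph of s to that of s r, with r a
    k-reflection, over a component of X containing a piece of the fixed space
    of r of codimension at most k. *)

Set Implicit Arguments.
Unset Strict Implicit.
Unset Printing Implicit Defensive.

Import GRing.Theory.

Local Open Scope classical_set_scope.
Local Open Scope ring_scope.

Lemma clos_rt_map (T T' : Type) (R : T -> T -> Prop) (R' : T' -> T' -> Prop)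
    (f : T -> T') : (forall x y, R x y -> R' (f x) (f y)) ->
  forall x y, clos_refl_trans _ R x y -> clos_refl_trans _ R' (f x) (f y).
Proof.
move=> fR x y; elim=> [{}x {}y Rxy|{}x|{}x {}y z _ xy _ yz].
- exact/rt_step/fR.
- exact: rt_refl.
- exact: rt_trans xy yz.
Qed.

(** * Irreducible sets, components and codimension in a topological space *)

Section IrreducibleSets.
Context {T : topologicalType}.
Implicit Types (Y Z W C A B : set T) (k m : nat).

Lemma irreducible_set1 (x : T) : irreducible [set x].
Proof.
split; first by exists x.
by move=> A B _ _ /(_ x erefl)[Ax|Bx]; [left|right] => _ ->.
Qed.

Lemma irreducible_closure Z : irreducible Z -> irreducible (closure Z).
Proof.
move=> [[z Zz] irrZ]; split; first by exists z; exact: subset_closure.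
move=> A B clA clB ZAB.
have [ZA|ZB] := irrZ A B clA clB (subset_trans (@subset_closure _ Z) ZAB).
- by left; rewrite ((closure_id A).1 clA); exact: closureS.
- by right; rewrite ((closure_id B).1 clB); exact: closureS.
Qed.

Lemma irreducible_sub_bigU (I : eqType) (r : seq I) (F : I -> set T) Z :
  irreducible Z -> (forall i, i \in r -> closed (F i)) ->
  Z `<=` \big[setU/set0]_(i <- r) F i -> exists2 i, i \in r & Z `<=` F i.
Proof.
move=> [[z Zz] irrZ]; elim: r => [|i r IHr] clF.
  by rewrite big_nil => /(_ z Zz).
have clr j : j \in r -> closed (F j).
  by move=> jr; apply: clF; rewrite inE jr orbT.
rewrite big_cons => ZF; case: (irrZ _ _ _ _ ZF).
- by apply: clF; rewrite inE eqxx.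
- exact: closed_bigsetU.
- by exists i; rewrite ?inE ?eqxx.
- by move=> /(IHr clr)[j jr ZFj]; exists j; rewrite ?inE ?jr ?orbT.
Qed.

(** Zorn's lemma gives a maximal irreducible subset of Z containing W. It is closed, because its
    closure is again irreducible and stays in Z. *)
Lemma irreducible_sub_component Z W : closed Z -> W `<=` Z -> irreducible W ->
  exists2 C, irreducible_component Z C & W `<=` C.
Proof.
move=> clZ WZ irrW.
(* Irreducibility is asked of the union with W, instead of asking that A contain W, so that the
   empty chain, whose union is empty, also satisfies [P]. *)
pose P A := irreducible (W `|` A) /\ A `<=` Z.
have chainP F : F `<=` P -> total_on F subset -> P (\bigcup_(A in F) A).
  move=> FP totF; split; last by move=> x [A /FP[_ AZ] /AZ].
  (* It suffices that any two points of the union share an irreducible subset of it: closed sets A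
     and B covering the union, neither containing it, would miss a point each. *)
  have common x y : (W `|` \bigcup_(A in F) A) x ->
      (W `|` \bigcup_(A in F) A) y ->
    exists C, [/\ C `<=` W `|` \bigcup_(A in F) A, irreducible C, C x & C y].
    have subF A : F A -> W `|` A `<=` W `|` \bigcup_(A in F) A.
      by move=> FA; apply: setUS => z Az; exists A.
    move=> [Wx|[A FA Ax]] [Wy|[B FB By]].
    - by exists W; split=> //; exact: subsetUl.
    - by exists (W `|` B); split; [exact: subF|case: (FP _ FB)|left|right].
    - by exists (W `|` A); split; [exact: subF|case: (FP _ FA)|right|left].
    - case: (totF A B FA FB) => sub.
        by exists (W `|` B); split;
          [exact: subF|case: (FP _ FB)|right; exact: sub|right].
      by exists (W `|` A); split;
        [exact: subF|case: (FP _ FA)|right|right; exact: sub].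
  case: irrW => [[w Ww] _]; split; first by exists w; left.
  move=> A B clA clB UAB; apply: contrapT => /not_orP[].
  move=> /existsNP[x /not_implyP[Ux nAx]] /existsNP[y /not_implyP[Uy nBy]].
  have [C [CU [_ irrC] Cx Cy]] := common x y Ux Uy.
  by case: (irrC A B clA clB (subset_trans CU UAB)) => [/(_ x Cx)|/(_ y Cy)].
have [A [[irrWA AZ] maxA]] := Zorn_bigcup chainP.
have WA : W `<=` A.
  apply: contrapT => nWA; apply: (maxA (W `|` A)).
    by split=> [|WAA]; [exact: subsetUr|apply: nWA => w Ww; apply: WAA; left].
  by split; [rewrite setUA setUid|move=> x []; [exact: WZ|exact: AZ]].
have maxA' B : irreducible B -> B `<=` Z -> A `<=` B -> B `<=` A.
  move=> irrB BZ AB; apply: contrapT => nBA; apply: (maxA B) => //.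
  by split=> //; rewrite setUidr//; exact: subset_trans AB.
have irrA : irreducible A by move: irrWA; rewrite setUidr.
have clAZ : closure A `<=` Z.
  by rewrite ((closure_id Z).1 clZ); exact: closureS.
have clA : closed A.
  rewrite (_ : A = closure A); first exact: closed_closure.
  apply/seteqP; split; first exact: subset_closure.
  by apply: maxA' => //; [exact: irreducible_closure|exact: subset_closure].
exists A => //; split=> // B [clB BZ irrB] AB.
by apply/seteqP; split=> //; exact: maxA'.
Qed.

(** By [irreducible_codim_leP] this says that [irreducible_codim Y W] is at most k; stated on
    chains, it avoids extended numbers. *)
Definition codim_bound k Y W :=
  forall m c, irreducible_chain Y W m c -> (m <= k)%N.

(* A proper chain starting at W' still is one after its first term is
   replaced by W. *)
Lemma codim_boundS k Y W W' : irreducible_closed_in Y W -> W `<=` W' ->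
  codim_bound k Y W -> codim_bound k Y W'.
Proof.
move=> irrW WW' kW [//|m] c [c0 irrc subc].
apply: (kW _ (fun i => if i is 0 then W else c i)); split=> //.
- by move=> [|i]//; exact: irrc.
- move=> [|i] im; last exact: subc.
  rewrite /=; have := subc _ im; rewrite c0; move=> [W'c nc].
  split; first exact: subset_trans W'c.
  by move=> cW; apply: nc; exact: subset_trans WW'.
Qed.

(** A witness W extends to a component of Z, whose codimension is no larger. Thus the components of
    an intersection never have to be determined. *)
Lemma codim_le_subP k Y Z : closed Z -> Z `<=` Y ->
  (codim Y Z <= (k%:R)%:E)%E <->
  exists2 W, irreducible_closed_in Z W & codim_bound k Y W.
Proof.
move=> clZ ZY; split=> [/codim_leP[W [irrW _] kW]|[W [clW WZ irrW] kW]].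
  by exists W.
have [C compC WC] := irreducible_sub_component clZ WZ irrW.
apply/codim_leP; exists C => //; apply: codim_boundS kW => //.
by split=> //; exact: subset_trans ZY.
Qed.

Lemma codim_bound_component k Y C :
  irreducible_component Y C -> codim_bound k Y C.
Proof.
move=> [_ maxC] [//|m] c [c0 irrc subc].
have := subc 0%N erefl; rewrite c0 => Cc1.
have := maxC _ (irrc 1%N erefl) (properW Cc1).
by move=> c1C; move: Cc1; rewrite c1C => -[].
Qed.

Definition adjacent k Y C D : Prop :=
  [/\ irreducible_component Y C, irreducible_component Y D &
      (codim Y (C `&` D) <= (k%:R)%:E)%E].

(** With a reflexive transitive closure in place of indexed sequences, paths can be mapped,
    concatenated and used for induction. *)
Lemma connected_in_codimP k Y : connected_in_codim k Y <->
  forall C D, irreducible_component Y C -> irreducible_component Y D ->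
    clos_refl_trans _ (adjacent k Y) C D.
Proof.
split=> conn C D compC compD.
  have [r [c [<- <- compc adjc]]] := conn _ _ compC compD.
  elim: r => [|r IHr] in compc adjc *; first exact: rt_refl.
  apply: (rt_trans _ _ _ (c r)).
    by apply: IHr => i ir; [apply: compc|apply: adjc]; exact: ltnW.
  by apply: rt_step; split; [exact: compc|exact: compc|exact: adjc].
have {conn compD} := clos_rt_rtn1 _ _ _ _ (conn _ _ compC compD).
elim=> [|{}D E [_ compE DE] _ [r [c [c0 cr compc adjc]]]].
  by exists 0%N, (fun=> C).
exists r.+1, (fun i => if (i <= r)%N then c i else E); split=> //.
- by rewrite ltnn.
- by move=> i _; case: leqP => // /compc.
- move=> i; rewrite ltnS => ir; rewrite ir.
  case: (ltnP i r) => [ltir|ri]; first exact: adjc.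
  by rewrite (@anti_leq i r) ?cr// ir.
Qed.

End IrreducibleSets.

(** * Continuity of polynomial maps *)

Section PolynomialMaps.
Context {K : closedFieldType}.

Definition polynomial_map n m (p : 'I_m -> mpoly n K) (x : affine_space K n) :
  affine_space K m := \row_j evalmp (p j) x.

Definition precompose n m (p : 'I_m -> mpoly n K) (q : mpoly m K) : mpoly n K :=
  comp_mpoly [tuple p j | j < m] q.

Lemma evalmp_precompose n m (p : 'I_m -> mpoly n K) (q : mpoly m K) x :
  evalmp (precompose p q) x = evalmp q (polynomial_map p x).
Proof.
rewrite /evalmp /precompose comp_mpoly_meval; apply: meval_eq => j.
by rewrite tnth_map tnth_ord_tuple mxE.
Qed.

Lemma closed_polynomial_preimage n m (p : 'I_m -> mpoly n K)
    (A : set (affine_space K m)) :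
  closed A -> closed (polynomial_map p @^-1` A).
Proof.
move=> /zariski_closedP[S ->]; apply/zariski_closedP.
exists (precompose p @` S); apply/seteqP; split=> x Sx.
  by move=> _ [q Sq <-]; rewrite evalmp_precompose; exact: Sx.
by move=> q Sq; rewrite -evalmp_precompose; apply: Sx; exists q.
Qed.

Lemma closed_polynomial_equalizer n m (p q : 'I_m -> mpoly n K) :
  closed [set x | polynomial_map p x = polynomial_map q x].
Proof.
apply/zariski_closedP; exists [set p j - q j | j in setT].
apply/seteqP; split=> x /=.
  move=> pq _ [j _ <-]; rewrite /evalmp mevalB.
  have := congr1 (fun y : 'rV__ => y ord0 j) pq.
  by rewrite !mxE /evalmp => ->; rewrite subrr.
move=> pq; apply/rowP => j; rewrite !mxE; apply/eqP; rewrite -subr_eq0.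
by rewrite /evalmp -mevalB; apply/eqP/pq; exists j.
Qed.

End PolynomialMaps.

(** Continuity is asked on X only, since the action is known to be polynomial only there. *)
Lemma irreducible_image (T T' : topologicalType) (f : T -> T') (X Z : set T) :
  (forall A, closed A -> closed (X `&` f @^-1` A)) ->
  Z `<=` X -> irreducible Z -> irreducible (f @` Z).
Proof.
move=> clf ZX [[z Zz] irrZ]; split; first by exists (f z), z.
move=> A B clA clB fZ.
have [|x Zx|ZA|ZB] := irrZ (X `&` f @^-1` A) (X `&` f @^-1` B) (clf A clA).
- exact: clf.
- have [] := fZ (f x) (ex_intro2 _ _ x Zx erefl).
    by left; split=> //; exact: ZX.
  by right; split=> //; exact: ZX.
- by left=> _ [x /ZA[_ ?] <-].
- by right=> _ [x /ZB[_ ?] <-].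
Qed.

(** * Invariants and orbits *)

Section SeparatingVariety.
Context {K : closedFieldType} {gT : finGroupType} (G : {group gT}) {n : nat}.
Context (X : set (affine_space K n)).
Context (act : gT -> affine_space K n -> affine_space K n).
Context (XG : Gvariety G X act).
Implicit Types (s t : gT) (C D W : set (affine_space K n)) (k : nat).

Local Notation coordinate j := (mpolyX K (mnm1 j)).
Local Notation V := (separating_variety G X act).

Let actK s x : s \in G -> X x -> act s^-1%g (act s x) = x.
Proof.
move=> sG Xx; rewrite -(Gvariety_actM XG)// ?groupV// mulVg.
exact: (Gvariety_act1 XG).
Qed.

Lemma separating_polynomial (x y : affine_space K n) : x <> y ->
  exists q : mpoly n K, evalmp q x = 0 /\ evalmp q y = 1.
Proof.
move=> xy; have [j xyj] : exists j, (x : 'rV_n) ord0 j != (y : 'rV_n) ord0 j.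
  apply: contrapT => /forallNP H; apply: xy; apply/rowP => j.
  by apply/eqP; apply: contrapT => /negP; exact: H.
pose d := (y : 'rV_n) ord0 j - (x : 'rV_n) ord0 j.
exists (d^-1 *: (coordinate j - mpolyC n ((x : 'rV_n) ord0 j))).
rewrite /evalmp !mevalZ !mevalB !mevalXU !mevalC subrr mulr0 mulVf//.
by rewrite subr_eq0 eq_sym.
Qed.

(* If y is not in the orbit of x, some polynomial Q vanishes on the orbit and
   takes the value 1 at y; the norm of 1 - Q then separates x from y. *)
Lemma invariants_separate_orbits (x y : affine_space K n) : X x -> X y ->
  (forall f, invariant_function G X act f -> f x = f y) ->
  exists2 s, s \in G & y = act s x.
Proof.
move=> Xx Xy inv; apply: contrapT => nxy.
have /choice[q qP] s : exists q : mpoly n K, s \in G ->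
    evalmp q (act s x) = 0 /\ evalmp q y = 1.
  have [sG|] := boolP (s \in G); last by exists 0.
  have [|q] := @separating_polynomial (act s x) y; last by exists q.
  by move=> yE; apply: nxy; exists s.
have /choice[p pP] s : exists p : 'I_n -> mpoly n K, s \in G ->
    forall z, X z -> act s z = polynomial_map p z.
  have [sG|] := boolP (s \in G); last by exists (fun=> 0).
  by have [p] := Gvariety_regular XG sG; exists p.
pose Q := \prod_(s in G) q s.
have evalQ z : evalmp Q z = \prod_(s in G) evalmp (q s) z.
  by rewrite /evalmp rmorph_prod.
pose f z := \prod_(s in G) (1 - evalmp Q (act s z)).
have invf : invariant_function G X act f.
  split.
    exists (\prod_(s in G) precompose (p s) (1 - Q)) => z Xz.
    rewrite /evalmp rmorph_prod; apply: eq_bigr => s sG.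
    rewrite -[RHS]/(evalmp (precompose (p s) (1 - Q)) z).
    by rewrite evalmp_precompose -pP// /evalmp mevalB meval1.
  (* Replacing t by t s in the product cancels the s^-1 applied to z. *)
  move=> s z sG Xz; rewrite /f (reindex_inj (mulIg s)) /=.
  apply: eq_big => [t|t]; rewrite groupMr// => tG.
  rewrite (Gvariety_actM XG)//; last first.
    by apply: (Gvariety_stable XG); rewrite ?groupV.
  have := @actK s^-1%g z; rewrite groupV invgK => -> //.
have fx : f x = 1.
  rewrite /f big1// => s sG; rewrite evalQ (bigD1 s)//=.
  by have [-> _] := qP s sG; rewrite mul0r subr0.
(* The factor of the identity is 1 - Q(y), and Q(y) = 1. *)
have fy : f y = 0.
  rewrite /f (bigD1 1%g)//= (Gvariety_act1 XG)// evalQ big1 ?subrr ?mul0r//.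
  by move=> s /qP[].
by have := inv f invf; rewrite fx fy => /eqP; rewrite oner_eq0.
Qed.

(** * Graphs of the group elements *)

Definition graph s (x : affine_space K n) : affine_space K (n + n) :=
  row_mx x (act s x).

Definition proj1 (z : affine_space K (n + n)) : affine_space K n := lsubmx z.

Lemma graphK s : cancel (graph s) proj1.
Proof. by move=> x; rewrite /proj1 /graph row_mxKl. Qed.

Lemma image_proj1_graph s C : proj1 @` (graph s @` C) = C.
Proof.
rewrite image_comp -[RHS]image_id; apply: eq_imagel => x _.
exact: graphK.
Qed.

Lemma separating_varietyE : V = \bigcup_(s in [set` G]) (graph s @` X).
Proof.
apply/seteqP; split=> [_ [x [y [-> Xx Xy inv]]]|_ [s /= sG [x Xx <-]]].
  have [s sG ->] := invariants_separate_orbits Xx Xy inv.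
  by exists s => //; exists x.
exists x, (act s x); split=> //; first exact: (Gvariety_stable XG).
move=> f [_ invf]; have sVG : s^-1%g \in G by rewrite groupV.
by rewrite -(invf _ _ sVG Xx) invgK.
Qed.

Lemma proj1_polynomial :
  proj1 = polynomial_map (fun j => coordinate (lshift n j)).
Proof.
by apply/funext => z; apply/rowP => j; rewrite !mxE /evalmp mevalXU.
Qed.

Lemma graph_polynomial s : s \in G -> exists q : 'I_(n + n) -> mpoly n K,
  forall x, X x -> graph s x = polynomial_map q x.
Proof.
move=> sG; have [p pP] := Gvariety_regular XG sG.
exists (fun j => match split j with inl i => coordinate i | inr i => p i end).
move=> x Xx; apply/rowP => j; rewrite !mxE.
case: split => i; first by rewrite /evalmp mevalXU.
by rewrite pP// mxE.
Qed.

Lemma closed_proj1_preimage C : closed C -> closed (proj1 @^-1` C).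
Proof. by rewrite proj1_polynomial; exact: closed_polynomial_preimage. Qed.

Lemma closed_graph_preimage s (A : set (affine_space K (n + n))) :
  s \in G -> closed A -> closed (X `&` graph s @^-1` A).
Proof.
move=> sG clA; have [q qP] := graph_polynomial sG.
rewrite (_ : _ `&` _ = X `&` polynomial_map q @^-1` A).
  by apply: closedI;
    [exact: (Gvariety_closed XG)|exact: closed_polynomial_preimage].
by apply/seteqP; split=> x [Xx Ax]; split=> //; move: Ax; rewrite /= qP.
Qed.

(** If q represents [graph s] on X, the graph over C is cut out by two closed conditions on z:
    [proj1 z] lies in C, and q maps [proj1 z] to z. *)
Lemma closed_graph_image s C : s \in G -> closed C -> C `<=` X ->
  closed (graph s @` C).
Proof.
move=> sG clC CX; have [q qP] := graph_polynomial sG.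
pose q' j := precompose (fun j => coordinate (lshift n j)) (q j).
have q'E z : polynomial_map q' z = polynomial_map q (proj1 z).
  by apply/rowP => j; rewrite !mxE evalmp_precompose proj1_polynomial.
have idE z : polynomial_map (fun j => coordinate j) z = z.
  by apply/rowP => j; rewrite !mxE /evalmp mevalXU.
rewrite (_ : _ @` _ = proj1 @^-1` C `&`
  [set z | polynomial_map q' z = polynomial_map (fun j => coordinate j) z]).
  by apply: closedI;
    [exact: closed_proj1_preimage|exact: closed_polynomial_equalizer].
apply/seteqP; split=> [_ [x Cx <-]|z /= [Cz]]; rewrite /= q'E idE.
  by rewrite graphK -qP//; exact: CX.
by move=> <-; exists (proj1 z) => //; apply: qP; exact: CX.
Qed.

(** * Irreducible closed subsets, components and codimension in the separating variety *)

Lemma irreducible_closed_graph s C : s \in G ->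
  irreducible_closed_in X C -> irreducible_closed_in V (graph s @` C).
Proof.
move=> sG [clC CX irrC]; split.
- exact: closed_graph_image.
- by rewrite separating_varietyE => _ [x Cx <-];
    exists s => //; exists x => //; exact: CX.
- by apply: irreducible_image CX irrC => A; exact: closed_graph_preimage.
Qed.

(** On the graph of s the projection is inverse to [graph s], so the image of Z is the preimage of Z
    under [graph s], which is closed. *)
Lemma irreducible_closed_sub_graph s (Z : set (affine_space K (n + n))) :
  s \in G -> irreducible_closed_in V Z -> Z `<=` graph s @` X ->
  irreducible_closed_in X (proj1 @` Z) /\ Z = graph s @` (proj1 @` Z).
Proof.
move=> sG [clZ _ irrZ] ZX.
have ZE : proj1 @` Z = X `&` graph s @^-1` Z.
  apply/seteqP; split=> [_ [z Zz <-]|x [Xx Zx]].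
    by have [x Xx xz] := ZX z Zz; rewrite -xz graphK; split=> //=; rewrite xz.
  by exists (graph s x) => //; rewrite graphK.
split.
  split; first by rewrite ZE; exact: closed_graph_preimage.
    by rewrite ZE => x [].
  apply: (@irreducible_image _ _ _ setT) => // A clA.
  by rewrite setTI; exact: closed_proj1_preimage.
apply/seteqP; split=> [z Zz|_ [_ [z Zz <-] <-]].
  by exists (proj1 z); [exists z|have [x _ <-] := ZX z Zz; rewrite graphK].
by have [x _ xz] := ZX z Zz; rewrite -xz graphK xz.
Qed.

(** The separating variety is a finite union of closed graphs, and an irreducible subset lies in one
    of them. *)
Lemma irreducible_closed_in_graph (Z : set (affine_space K (n + n))) :
  irreducible_closed_in V Z -> exists2 s, s \in G & Z `<=` graph s @` X.
Proof.
move=> [_ ZV irrZ].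
have [||s] := @irreducible_sub_bigU _ _ (enum G) (fun s => graph s @` X) Z irrZ.
- move=> s; rewrite mem_enum => sG.
  by apply: closed_graph_image => //; exact: (Gvariety_closed XG).
- move: ZV; rewrite separating_varietyE -bigcup_seq => /subset_trans; apply.
  by apply: bigcup_subset => // s; rewrite /= mem_enum.
- by rewrite mem_enum; exists s.
Qed.

(** A larger irreducible closed Z lies in the graph of some t, and it projects onto C by maximality
    of C. *)
Lemma component_graph s C : s \in G ->
  irreducible_component X C -> irreducible_component V (graph s @` C).
Proof.
move=> sG [irrC maxC]; split; first exact: irreducible_closed_graph.
move=> Z irrZ CZ; have [t tG ZX] := irreducible_closed_in_graph irrZ.
have [irrpZ ZE] := irreducible_closed_sub_graph tG irrZ ZX.
have pZC : proj1 @` Z = C.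
  apply: maxC => //; rewrite -[A in A `<=` _](image_proj1_graph s).
  exact: image_subset.
(* The element t may differ from s, but over C the points of the graph of s lie on that of t, so
   both act equally on C. *)
rewrite ZE pZC; apply: eq_imagel => x Cx.
have : Z (graph s x) by apply: CZ; exists x.
rewrite ZE => -[x' _] xx'; have := congr1 proj1 xx'.
by rewrite !graphK -xx' => ->.
Qed.

(** The projection of Z lies in a component C of X; the graph over C is irreducible and contains Z,
    so maximality of Z gives equality. *)
Lemma component_separating_variety (Z : set (affine_space K (n + n))) :
  irreducible_component V Z ->
  exists s C, [/\ s \in G, irreducible_component X C & Z = graph s @` C].
Proof.
move=> [irrZ maxZ]; have [s sG ZX] := irreducible_closed_in_graph irrZ.
have [[_ pZX irrpZ] ZE] := irreducible_closed_sub_graph sG irrZ ZX.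
have [C compC ZC] := irreducible_sub_component (Gvariety_closed XG) pZX irrpZ.
exists s, C; split=> //; apply/esym/maxZ.
  by apply: irreducible_closed_graph => //; case: compC.
by rewrite ZE; exact: image_subset.
Qed.

(** Chains in X lift to the graph of s. Conversely, the top of a chain in the separating variety
    lies in the graph of one t, possibly not s, hence so does the whole chain, and it projects to a
    proper chain in X. *)
Lemma codim_bound_graph k s W : s \in G -> irreducible_closed_in X W ->
  codim_bound k V (graph s @` W) <-> codim_bound k X W.
Proof.
move=> sG irrW; split=> kW m c [c0 irrc subc].
  apply: (kW m (fun i => graph s @` c i)); split; first by rewrite c0.
    by move=> i im; apply: irreducible_closed_graph => //; exact: irrc.
  move=> i /subc[cc ncc]; split; first exact: image_subset.
  by move=> /(@image_subset _ _ proj1); rewrite !image_proj1_graph.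
have [t tG cmX] := irreducible_closed_in_graph (irrc m (leqnn m)).
have cX i : (i <= m)%N -> c i `<=` graph t @` X.
  (* Downward induction from the top of the chain, with i written as m - j. *)
  move=> im; apply: subset_trans cmX; rewrite -(subKn im).
  elim: (m - i)%N (leq_subr i m) => [|j IHj] jm; first by rewrite subn0.
  apply: subset_trans (IHj (ltnW jm)).
  have ltm : (m - j.+1 < m)%N by rewrite ltn_subrL (leq_ltn_trans _ jm).
  by have := properW (subc _ ltm); rewrite subnSK.
have irrpc i (im : (i <= m)%N) :=
  irreducible_closed_sub_graph tG (irrc i im) (cX i im).
apply: (kW m (fun i => proj1 @` c i)); split.
- by rewrite c0 image_proj1_graph.
- by move=> i /irrpc[].
- move=> i im; have [cc ncc] := subc i im; split; first exact: image_subset.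
  move=> /(@image_subset _ _ (graph t)).
  by rewrite -(irrpc _ im).2 -(irrpc _ (ltnW im)).2.
Qed.

(** The two graphs meet exactly over the points of C and D where s and t agree. Irreducible closed
    subsets of the intersection are therefore graphs over sets W of such points, and
    [codim_bound_graph] transfers their codimension. *)
Lemma codim_graphI k s t C D : s \in G -> t \in G ->
  closed C -> C `<=` X -> closed D -> D `<=` X ->
  (codim V (graph s @` C `&` graph t @` D) <= (k%:R)%:E)%E <->
  exists W, [/\ irreducible_closed_in X W, W `<=` C `&` D,
    (forall x, W x -> act s x = act t x) & codim_bound k X W].
Proof.
move=> sG tG clC CX clD DX.
have CV : graph s @` C `<=` V.
  by rewrite separating_varietyE => _ [x Cx <-];
    exists s => //; exists x => //; exact: CX.
have clCD := closedI (closed_graph_image sG clC CX)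
  (closed_graph_image tG clD DX).
rewrite codim_le_subP//; last by move=> z [/CV].
split=> [[Z [clZ ZCD irrZ] kZ]|[W [irrW WCD stW kW]]].
  have irrVZ : irreducible_closed_in V Z by split=> // z /ZCD[/CV].
  have ZX : Z `<=` graph s @` X by move=> z /ZCD[[x /CX ? <-] _]; exists x.
  have [irrpZ ZE] := irreducible_closed_sub_graph sG irrVZ ZX.
  exists (proj1 @` Z); split=> //.
  - move=> _ [z /ZCD[[x Cx <-] [y Dy yx]] <-].
    by have := congr1 proj1 yx; rewrite !graphK => xy; split=> //; rewrite -xy.
  - move=> _ [z /ZCD[[x Cx <-] [y Dy yx]] <-].
    have := congr1 proj1 yx; rewrite !graphK => xy.
    by move: yx; rewrite xy => /eq_row_mx[].
  - by apply/(codim_bound_graph k sG irrpZ); rewrite -ZE.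
have [irrVW1 irrVW2 irrVW3] := irreducible_closed_graph sG irrW.
exists (graph s @` W); last exact/codim_bound_graph.
split=> // _ [x Wx <-]; have [Cx Dx] := WCD x Wx.
by split; exists x; rewrite ?/graph ?stW.
Qed.

(** * Fixed spaces and reflections *)

Lemma closed_component (C : set (affine_space K n)) :
  irreducible_component X C -> closed C /\ C `<=` X.
Proof. by move=> [[]]. Qed.

Lemma reflectionP k s : s \in G ->
  reflection X act k s <->
  exists W, [/\ irreducible_closed_in X W, (forall x, W x -> act s x = x) &
    codim_bound k X W].
Proof.
move=> sG; rewrite /reflection.
have fixX : fixed_space X act s `<=` X by move=> x [].
rewrite codim_le_subP//.
  split=> [[W [clW Ws irrW] kW]|[W [[clW WX irrW] Ws kW]]]; exists W => //.
    by split=> //; [split=> //; exact: subset_trans fixX|move=> x /Ws[]].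
  by split=> // x Wx; split; [exact: WX|exact: Ws].
have clX := Gvariety_closed XG.
(* The fixed space is closed, as the set of points where the graph of s meets that of the
   identity. *)
rewrite (_ : fixed_space _ _ _ = X `&` graph s @^-1` (graph 1%g @` X)).
  by apply: closed_graph_preimage => //; apply: closed_graph_image;
    rewrite ?group1.
apply/seteqP; split=> [x [Xx sx]|x [Xx [y Xy xy]]]; split=> //.
  by exists x => //; rewrite /graph sx (Gvariety_act1 XG).
by have := eq_row_mx xy; rewrite (Gvariety_act1 XG)// => -[<- <-].
Qed.

Lemma reflection_of_codim_graphI k s t C D : s \in G -> t \in G ->
  irreducible_component X C -> irreducible_component X D ->
  (codim V (graph s @` C `&` graph t @` D) <= (k%:R)%:E)%E ->
  reflection X act k (s^-1 * t)%g.
Proof.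
move=> sG tG /closed_component[clC CX] /closed_component[clD DX].
move=> /(codim_graphI k sG tG clC CX clD DX)[W [irrW _ stW kW]].
apply/reflectionP; first by rewrite groupM ?groupV.
exists W; split=> // x Wx; have Xx : X x by case: irrW => _ WX _; exact: WX.
by rewrite (Gvariety_actM XG) ?groupV// -stW// actK.
Qed.

(** * Paths of components in X and in the separating variety *)

Lemma adjacent_proj1 k (A B : set (affine_space K (n + n))) :
  adjacent k V A B -> adjacent k X (proj1 @` A) (proj1 @` B).
Proof.
move=> [/component_separating_variety[s [C [sG compC ->]]]].
move=> /component_separating_variety[t [D [tG compD ->]]].
have [[clC CX] [clD DX]] := (closed_component compC, closed_component compD).
move=> /(codim_graphI k sG tG clC CX clD DX)[W [[clW WX irrW] WCD _ kW]].
rewrite !image_proj1_graph; split=> //; apply/codim_le_subP.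
- exact: closedI.
- by move=> x [/CX].
- by exists W.
Qed.

Lemma adjacent_graph k s C D : s \in G ->
  adjacent k X C D -> adjacent k V (graph s @` C) (graph s @` D).
Proof.
move=> sG [compC compD].
have [[clC CX] [clD DX]] := (closed_component compC, closed_component compD).
have CDX : C `&` D `<=` X by move=> x [/CX].
move=> /(codim_le_subP k (closedI clC clD) CDX)[W [clW WCD irrW] kW].
split; [exact: component_graph|exact: component_graph|].
apply/codim_graphI => //; exists W; split=> //.
by split=> //; exact: subset_trans CDX.
Qed.

Lemma adjacent_graph_reflection k s r : s \in G -> r \in G ->
  reflection X act k r -> exists2 C, irreducible_component X C &
  adjacent k V (graph s @` C) (graph (s * r)%g @` C).
Proof.
move=> sG rG /(reflectionP k rG)[W [irrW rW kW]].
have [clW WX irrW'] := irrW.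
have [C compC WC] := irreducible_sub_component (Gvariety_closed XG) WX irrW'.
have [clC CX] := closed_component compC.
have srG : (s * r)%g \in G by rewrite groupM.
exists C => //; split; [exact: component_graph|exact: component_graph|].
apply/codim_graphI => //; exists W; split=> //.
  by move=> x Wx; split; exact: WC.
by move=> x Wx; rewrite (Gvariety_actM XG)// ?rW//; exact: WX.
Qed.

Lemma connected_in_codim_proj1 k :
  connected_in_codim k V -> connected_in_codim k X.
Proof.
move=> /connected_in_codimP conn; apply/connected_in_codimP => C D compC compD.
rewrite -(image_proj1_graph 1%g C) -(image_proj1_graph 1%g D).
apply: (clos_rt_map (@adjacent_proj1 k)).
by apply: conn; apply: component_graph.
Qed.

(** For empty X there are no reflections, as the empty set has codimension [+oo], so a nontrivial G
    would be a counterexample. A point of X yields a component C at which to start paths. *)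
Lemma generated_by_reflections_of_connected k : X !=set0 ->
  connected_in_codim k V -> generated_by_reflections G X act k.
Proof.
move=> [x Xx] /connected_in_codimP conn; rewrite /generated_by_reflections.
set N := <<_>>%g.
have NP s : s \in G -> reflection X act k s -> s \in N.
  by move=> sG rs; apply: mem_gen; rewrite inE sG; apply/asboolP.
apply/eqP; rewrite finset.eqEsubset gen_subG; apply/andP; split.
  by apply/fintype.subsetP => s; rewrite inE => /andP[].
have [|C compC _] := irreducible_sub_component (Gvariety_closed XG) _
  (irreducible_set1 x).
  by move=> _ ->.
(* A component Z may be the graph of several group elements, so the induction along the path treats
   all of them at once. *)
suff key (Z : set (affine_space K (n + n))) :
    clos_refl_trans _ (adjacent k V) (graph 1%g @` C) Z ->
    forall t D, t \in G -> irreducible_component X D ->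
      Z = graph t @` D -> t \in N.
  apply/fintype.subsetP => t tG; apply: (key _ _ t C tG compC erefl).
  by apply: conn; apply: component_graph.
move=> CZ; elim: {Z CZ} (clos_rt_rtn1 _ _ _ _ CZ) =>
  [|Z Z' [compZ _ ZZ'] _ IH] t D tG compD ZE.
  (* Here the graphs of 1 and t coincide on a component. Their intersection has codimension 0, so t
     itself is a reflection. *)
  have compZ := component_graph (group1 G) compC.
  have := @reflection_of_codim_graphI k _ _ _ _ (group1 G) tG compC compD.
  rewrite invg1 mul1g -ZE setIid => /(_ _)/NP; apply => //.
  have [irrZ _] := compZ; have [clZ ZV _] := irrZ.
  apply/codim_le_subP => //; exists (graph 1%g @` C).
    by case: irrZ; split.
  exact: codim_bound_component.
(* Write t = s (s^-1 t): s is in N by induction, and s^-1 t is a reflection since the graphs of s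
   and t are adjacent. *)
have [s [E [sG compE ZsE]]] := component_separating_variety compZ.
rewrite -(mulKVg s t) groupM ?(IH _ _ sG compE ZsE)// NP ?groupM ?groupV//.
by apply: reflection_of_codim_graphI sG tG compE compD _; rewrite -ZE -ZsE.
Qed.

Lemma connected_of_generated_by_reflections k : connected_in_codim k X ->
  generated_by_reflections G X act k -> connected_in_codim k V.
Proof.
move=> /connected_in_codimP conn genG; apply/connected_in_codimP.
(* Quantifying over s and over both components makes the linked elements closed under products; they
   form a subgroup H, which has to contain the reflections. *)
pose linked g := forall s C D, s \in G ->
  irreducible_component X C -> irreducible_component X D ->
  clos_refl_trans _ (adjacent k V) (graph s @` C) (graph (s * g)%g @` D).
have linked1 : linked 1%g.
  move=> s C D sG compC compD; rewrite mulg1.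
  apply: (clos_rt_map (fun _ _ => @adjacent_graph k s _ _ sG)).
  exact: conn compC compD.
pose H := [set g in G | `[< linked g >]]%SET.
have gH : group_set H.
  apply/group_setP; split; first by rewrite inE group1; apply/asboolP.
  move=> g h; rewrite !inE => /andP[gG /asboolP lg] /andP[hG /asboolP lh].
  rewrite groupM//; apply/asboolP => s C D sG compC compD; rewrite mulgA.
  apply: rt_trans (lg s C C sG compC compC) _.
  by apply: lh => //; rewrite groupM.
have GH : G \subset H.
  rewrite -{1}genG (gen_subG _ (Group gH)); apply/fintype.subsetP => r.
  rewrite !inE => /andP[rG /asboolP rr]; rewrite rG.
  apply/asboolP => s C D sG compC compD.
  (* The path goes from C to E in the graph of s, crosses over E to the graph of s r, and continues
     there to D. *)
  have [E compE adjE] := adjacent_graph_reflection sG rG rr.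
  have srG : (s * r)%g \in G by rewrite groupM.
  have := linked1 s C E sG compC compE; rewrite mulg1 => CE.
  have := linked1 (s * r)%g E D srG compE compD; rewrite mulg1.
  by apply: rt_trans; apply: rt_trans CE _; exact: rt_step.
move=> Z Z' /component_separating_variety[s [C [sG compC ->]]].
move=> /component_separating_variety[t [D [tG compD ->]]].
have : (s^-1 * t)%g \in H.
  by apply: (fintype.subsetP GH); rewrite groupM ?groupV.
rewrite inE => /andP[_ /asboolP/(_ s C D sG compC compD)].
by rewrite mulKVg.
Qed.

End SeparatingVariety.

Theorem theorem1p5 (K : closedFieldType) (gT : finGroupType) (G : {group gT})
  (n : nat) (X : set (affine_space K n))
  (act : gT -> affine_space K n -> affine_space K n) (k : nat)
  (X_nonempty : nonempty X) (X_Gvariety : Gvariety G X act) :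
  connected_in_codim k (separating_variety G X act) <->
  connected_in_codim k X /\ generated_by_reflections G X act k.
Proof.
split=> [connV|[connX genG]].
  split; first exact: connected_in_codim_proj1 connV.
  exact: generated_by_reflections_of_connected connV.
exact: connected_of_generated_by_reflections.
Qed.
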